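(* There exists an infinite op-square-free word over a $3$-letter totally ordered alphabet.
   Context: An order-preserving square is a word $uv$ with $|u|=|v|\ge 1$ and a strictly increasing bijection $f:\mathrm{Alph}(u)\to\mathrm{Alph}(v)$ ($\mathrm{Alph}$ = set of letters occurring) with $v[t]=f(u[t])$ for all $t$. A (finite or infinite) word is op-square-free if none of its finite factors is an order-preserving square of length greater than $2$. *)

(* Defs.v *)
From HB Require Import structures.
From mathcomp Require Import all_boot all_order.
Set Implicit Arguments.
Unset Strict Implicit.
Unset Printing Implicit Defensive.
Import Order.TTheory.

Section OpSquares.

Context {d : Order.disp_t} {T : finOrderType d}.
Implicit Types u v s : seq T.

Definition Alph s : {set T} := [set x in s].

(* The bijection Alph u -> Alph v is carried by a total function f : T -> T,
   of which only the restriction to Alph u is constrained. *)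
Definition increasing_bij (A B : {set T}) (f : T -> T) : Prop :=
  [/\ {in A &, injective f}, f @: A = B
    & {in A &, {homo f : x y / (x < y)%O}}].

Definition op_square s : Prop :=
  exists u v : seq T,
    [/\ s = u ++ v, size u = size v, 1 <= size u
      & exists2 f : T -> T, increasing_bij (Alph u) (Alph v) f & v = map f u].

Definition factor (w : nat -> T) (i n : nat) : seq T :=
  mkseq (fun k => w (i + k)) n.

Definition op_square_free (w : nat -> T) : Prop :=
  forall i n : nat, 2 < n -> ~ op_square (factor w i n).

End OpSquares.

(* Main.v *)
Require Import Defs.
From mathcomp Require Import all_boot all_order.
From mathcomp Require Import zify.
Import Order.TTheory.

(** Let [t] be the Thue-Morse word.  It is overlap-free: an overlap of even
    period halves, and an overlap of odd period would force [t] to alternate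
    over a whole period.  Hence the word of its successive differences is a
    square-free word [x0 x1 x2 ...] over three letters.  The required word is
    [1 x0 1 x1 1 x2 ...], where [1] is the middle letter.  In an
    order-preserving square of even half-length the letter [1] corresponds to
    itself, so the bijection is the identity and [x] has a square; in one of odd
    half-length at least [3] two occurrences of [1] at distance [2] correspond
    to two consecutive letters of [x], which are therefore equal. *)

Fixpoint bit_parity (fuel n : nat) : bool :=
  if fuel is k.+1 then odd n (+) bit_parity k n./2 else false.

(** The parity of the number of ones in the binary expansion of [n]; [n] halvings suffice to reach
    0. *)
Definition thue_morse (n : nat) : bool := bit_parity n n.

Lemma bit_parity_fuel (k n : nat) : n <= k -> bit_parity k n = thue_morse n.
Proof.
have fuel a b m : m <= a -> m <= b -> bit_parity a m = bit_parity b m.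
  elim: a b m => [|a IHa] [|b] m //= ma mb.
  - by move: ma; rewrite leqn0 => /eqP ->; elim: b {mb} => //= b <-.
  - move: mb; rewrite leqn0 => /eqP ->.
    by elim: a {IHa ma} => //= a ->.
  by congr (_ (+) _); apply: IHa; lia.
by move=> nk; apply: fuel.
Qed.

Lemma thue_morseE (n : nat) : thue_morse n = odd n (+) thue_morse n./2.
Proof.
case: n => [//|n]; rewrite /thue_morse -/(thue_morse _) /=.
by congr (_ (+) _); apply: bit_parity_fuel; lia.
Qed.

Lemma thue_morse_double (b : bool) (n : nat) :
  thue_morse (b + n.*2) = b (+) thue_morse n.
Proof. by rewrite thue_morseE half_bit_double oddD odd_double addbF oddb. Qed.

Lemma thue_morseS (n : nat) : ~~ odd n -> thue_morse n.+1 = ~~ thue_morse n.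
Proof.
move=> ev; have -> : n = false + n./2.*2 by lia.
by rewrite -add1n addnCA (thue_morse_double true) (thue_morse_double false).
Qed.

Lemma thue_morse_overlap_free (i l : nat) : 0 < l ->
  ~ (forall k, k <= l -> thue_morse (i + k) = thue_morse (i + l + k)).
Proof.
elim/ltn_ind: l i => l IHl i l0 ov.
have [oddl|evl] := boolP (odd l).
  have step p : i <= p < i + l -> thue_morse p.+1 = ~~ thue_morse p.
    move=> /andP[ip pl]; have [oddp|] := boolP (odd p); last exact: thue_morseS.
    (* Here [p + l] is even, so [thue_morse] flips right after it, and the overlap carries this flip
       back to [p]. *)
    have ovp : thue_morse p = thue_morse (p + l).
      have := ov (p - i); rewrite (_ : i + l + (p - i) = p + l); last by lia.
      by rewrite subnKC // => ->; lia.
    have ovp1 : thue_morse p.+1 = thue_morse (p + l).+1.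
      have := ov (p.+1 - i).
      rewrite (_ : i + l + (p.+1 - i) = (p + l).+1); last by lia.
      by rewrite subnKC ?(leq_trans ip) // => ->; lia.
    by rewrite ovp1 ovp thue_morseS // oddD oddp oddl.
  have alt k : k <= l -> thue_morse (i + k) = odd k (+) thue_morse i.
    elim: k => [|k IHk] kl; first by rewrite addn0.
    by rewrite addnS step ?IHk ?(ltnW kl) //= ?addNb // leq_addr ltn_add2l.
  by have := ov 0 isT; rewrite !addn0 alt // oddl; case: thue_morse.
(* Sampling the positions of the same parity as [i] leaves an overlap of period [l./2]. *)
apply: (IHl l./2 _ i./2); [lia|lia|] => k kl.
have := ov k.*2; rewrite (_ : i + k.*2 = odd i + (i./2 + k).*2); last by lia.
rewrite (_ : i + l + k.*2 = odd i + (i./2 + l./2 + k).*2); last by lia.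
by rewrite !thue_morse_double => /(_ _)/addbI; apply; lia.
Qed.

(* The difference [t (n+1) - t n]: [None] stands for 0, [Some false] for 1 and
   [Some true] for -1. *)
Definition thue_morse_diff (n : nat) : option bool :=
  if thue_morse n == thue_morse n.+1 then None else Some (thue_morse n).

Lemma thue_morse_diff_square_free (p m : nat) : 0 < m ->
  ~ (forall q, q < m -> thue_morse_diff (p + q) = thue_morse_diff (p + m + q)).
Proof.
move=> m0 sq; have [eqt|neqt] := eqVneq (thue_morse p) (thue_morse (p + m)).
  (* Equal differences propagate the equality of the values up to offset [m]. *)
  apply: (@thue_morse_overlap_free p m) => // k.
  elim: k => [|k IHk] km; first by rewrite !addn0.
  have := sq k km; rewrite /thue_morse_diff !addnS (IHk (ltnW km)).
  by do 3!case: thue_morse.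
(* Equal differences starting from different values must vanish, so [t] is
   constant on [p, p + m]. *)
have cst k : k <= m -> thue_morse (p + k) = thue_morse p
             /\ thue_morse (p + m + k) = thue_morse (p + m).
  elim: k => [|k IHk] km; first by rewrite !addn0.
  have [] := IHk (ltnW km); have := sq k km; rewrite /thue_morse_diff !addnS.
  move=> + e1 e2; move: neqt; rewrite -e1 -e2.
  by do 4!case: thue_morse.
by have [e _] := cst m (leqnn m); rewrite e eqxx in neqt.
Qed.

Section InterleavedWord.

Context {d : Order.disp_t} {T : finOrderType d}.

(** On a total order a strictly increasing [f] also reflects [<], so it can be traded for
    comparisons inside the two halves. *)
Lemma op_square_factorP (w : nat -> T) (i n : nat) :
  op_square (factor w i n) ->
  exists l, n = l.*2 /\
    {in gtn l &, forall j k, (w (i + j) < w (i + k))%O =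
                             (w (i + l + j) < w (i + l + k))%O}.
Proof.
move=> [u [v [fact_uv szuv _ [f [_ _ f_lt] vfu]]]].
have sz : n = (size u).*2.
  by rewrite -addnn {2}szuv -size_cat -fact_uv size_mkseq.
have nth_w k : k < n -> nth (w 0) (u ++ v) k = w (i + k).
  by move=> kn; rewrite -fact_uv nth_mkseq.
exists (size u); split=> // j k; rewrite !inE => jl kl.
have wu a : a < size u -> w (i + a) = nth (w 0) u a.
  by move=> al; rewrite -nth_w ?nth_cat ?al //; lia.
have wv a : a < size u -> w (i + size u + a) = f (w (i + a)).
  move=> al; rewrite -addnA -nth_w; last by lia.
  by rewrite nth_cat ltnNge leq_addr /= addKn vfu (nth_map (w 0)) // wu.
have in_u a : a < size u -> w (i + a) \in Alph u.
  by move=> al; rewrite inE wu // mem_nth.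
have f_mono : {in Alph u &, {mono f : x y / (x < y)%O}}.
  exact: leW_mono_in (le_mono_in f_lt).
by rewrite !wv // f_mono ?in_u.
Qed.

Variables lo mid hi : T.
Hypotheses (lo_mid : (lo < mid)%O) (mid_hi : (mid < hi)%O).

Definition letter (x : option bool) : T :=
  if x is Some b then if b then hi else lo else mid.

(** Each side of [mid] holds only one of the three letters. *)
Lemma letter_cmp_mid (x y : option bool) :
  (letter x < mid)%O = (letter y < mid)%O ->
  (mid < letter x)%O = (mid < letter y)%O -> x = y.
Proof.
by case: x y => [[]|] [[]|] //=;
  rewrite ?ltxx ?lo_mid ?mid_hi ?(lt_gtF lo_mid) ?(lt_gtF mid_hi).
Qed.

Variable x : nat -> option bool.
Hypothesis x_square_free : forall p m, 0 < m ->
  ~ (forall q, q < m -> x (p + q) = x (p + m + q)).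

Definition interleave (n : nat) : T := if odd n then letter (x n./2) else mid.

Lemma x_neqS (p : nat) : x p <> x p.+1.
Proof.
move=> e; apply: (@x_square_free p 1) => // -[|//] _.
by rewrite !addn0 addn1.
Qed.

Lemma interleave_neq_add2 (n : nat) : odd n -> interleave n <> interleave n.+2.
Proof.
move=> on; rewrite /interleave /= negbK on => e.
by apply: (@x_neqS n./2); apply: letter_cmp_mid; rewrite e.
Qed.

Lemma interleave_op_square_free : op_square_free interleave.
Proof.
move=> i n n2 /op_square_factorP[l [nl ltE]]; rewrite {n}nl in n2.
have eqE j k : j < l -> k < l ->
    (interleave (i + j) == interleave (i + k)) =
    (interleave (i + l + j) == interleave (i + l + k)).
  by move=> jl kl; rewrite !eq_le !leNgt !ltE.
have even_mid p : ~~ odd p -> interleave p = mid.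
  by rewrite /interleave => /negbTE ->.
have [ol|el] := boolP (odd l).
  (* As [i] and [i + l] differ in parity, offsets 0 and 2 both carry [mid] in one half and
     consecutive letters of [x] in the other. Offset 2 is available since [l] is odd and above 1. *)
  have := eqE 0 2; rewrite !addn0 !addn2 => /(_ _ _) E.
  have [oi|ei] := boolP (odd i).
    have := @interleave_neq_add2 i oi; apply; apply/eqP; rewrite E; try lia.
    by rewrite !even_mid //=; lia.
  have := @interleave_neq_add2 (i + l); apply; first by lia.
  by apply/eqP; rewrite -E; try lia; rewrite !even_mid //=; lia.
apply: (@x_square_free i./2 l./2) => [|q ql]; first by lia.
(* Offset [k] points at the letter of [x] with index [i./2 + q], and [c], which is 0 or 1, at an
   occurrence of [mid], in both halves because [l] is even. *)
pose k := ~~ odd i + q.*2; pose c : nat := odd i.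
have kl : k \in gtn l by rewrite inE /k; lia.
have cl : c \in gtn l by rewrite inE /c; lia.
have wk : interleave (i + k) = letter (x (i./2 + q)).
  rewrite /interleave (_ : odd (i + k)); last by rewrite /k; lia.
  by congr (letter (x _)); rewrite /k; lia.
have wlk : interleave (i + l + k) = letter (x (i./2 + l./2 + q)).
  rewrite /interleave (_ : odd (i + l + k)); last by rewrite /k; lia.
  by congr (letter (x _)); rewrite /k; lia.
have wc : interleave (i + c) = mid by apply: even_mid; rewrite /c; lia.
have wlc : interleave (i + l + c) = mid by apply: even_mid; rewrite /c; lia.
by apply: letter_cmp_mid; rewrite -wk -wlk -{1}wc -{1}wlc; apply: ltE.
Qed.

End InterleavedWord.

Lemma card_gt2_lt_lt (d : Order.disp_t) (T : finOrderType d) :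
  2 < #|T| -> exists a b c : T, (a < b)%O /\ (b < c)%O.
Proof.
rewrite cardE -(size_sort <=%O%O) => sz.
have : sorted <%O%O (sort <=%O%O (enum T)).
  by rewrite sort_lt_sorted enum_uniq.
case: sort sz => [|a [|b [|c s]]] //= _ /and3P[ab bc _].
by exists a, b, c.
Qed.

Theorem theorem31 (d : Order.disp_t) (T : finOrderType d) (hT : #|T| = 3) :
  exists w : nat -> T, op_square_free w.
Proof.
have [|lo [mid [hi [lo_mid mid_hi]]]] := @card_gt2_lt_lt d T; first by rewrite hT.
exists (interleave lo mid hi thue_morse_diff).
exact: interleave_op_square_free thue_morse_diff_square_free.
Qed.
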